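(* There is a universal constant $c>0$ such that the following holds. For every integer $d\ge 2$ there exist a state space $\mathcal S$, an action space $\mathcal A$ and a feature mapping $\phi:\mathcal S\times\mathcal A\to\mathbb R^d$ such that for any $p,q\ge1$ with $1/p+1/q=1$ (with $p=\infty$ allowed when $q=1$), any $\Lambda\ge\sqrt8\cdot d^{1/q-1/2}$ and any sample size $n\ge d^{2/p}\Lambda^2$, $$\inf_{\hat\pi}\ \sup_{\mathcal Q\in\mathsf{CB}_q(\Lambda)}\ \mathbb E\big[V^\star_{\mathcal Q}-V_{\mathcal Q}(\hat\pi)\big]\ \ge\ c\cdot d^{1/p}\sqrt{\frac1n}\cdot\Lambda ,$$ where the infimum is over all learning rules. Furthermore, when $p=\infty$, $q=1$, the lower bound holds for the extended range $\Lambda\ge2$ (with $n\ge \Lambda^2$).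
   Context: Offline linear contextual bandit: $\phi:\mathcal S\times\mathcal A\to\mathbb R^d$ is a feature map. An instance $\mathcal Q=(\rho,\{(s_i,a_i)\}_{i=1}^n,\theta^\star,R)$ consists of a (test) probability distribution $\rho$ on $\mathcal S$, fixed covariates $(s_i,a_i)\in\mathcal S\times\mathcal A$, a parameter $\theta^\star\in\mathbb R^d$, and reward distributions $R(s,a)$ with mean $\phi(s,a)^\top\theta^\star$. The dataset is $\mathcal D=\{(s_i,a_i,r_i)\}_{i=1}^n$ with $r_i\sim R(s_i,a_i)$ independent. A learning rule maps the dataset (with $\phi,\rho$ known) to a deterministic policy $\hat\pi:\mathcal S\to\mathcal A$. The value of a policy in $\mathcal Q$ is $V_{\mathcal Q}(\pi)=\mathbb E_{s\sim\rho}[\phi(s,\pi(s))^\top\theta^\star]$, the optimal policy is $\pi^\star(s)\in\arg\max_a\phi(s,a)^\top\theta^\star$, and $V^\star_{\mathcal Q}=V_{\mathcal Q}(\pi^\star)$. The expectation is over the dataset drawn from $\mathcal Q$. Let $\Sigma_{\mathcal D}=\frac1n\sum_{i=1}^n\phi(s_i,a_i)\phi(s_i,a_i)^\top$ (assumed invertible), with $\Sigma_{\mathcal D}^{1/2}$ its positive semidefinite square root. For given $\phi$, $n$, for $q\in[1,\infty)$ and $\Lambda>0$, $\mathsf{CB}_q(\Lambda)$ is the set of all instances with $n$ covariates such that $\|\Sigma_{\mathcal D}^{-1/2}\mathbb E_{s\sim\rho}[\phi(s,\pi^\star(s))]\|_q\le\Lambda$ and every $R(s,a)$ is 1-subgaussian.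 ($X$ is $\sigma^2$-subgaussian if $\mathbb P[|X-\mathbb EX|\ge t]\le2e^{-t^2/(2\sigma^2)}$ for all $t\ge0$.) The convention $1/\infty=0$ is used.
   Formalization: In the extended range (p=∞, q=1) the sample size is also required to satisfy n ≥ d; for n < d the matrix Σ_D is never invertible, so CB_1(Λ) is empty and the bound fails. *)

(* Defs.v *)
From HB Require Import structures.
From mathcomp Require Import all_boot all_order all_algebra.
From mathcomp Require Import all_classical all_reals all_analysis.
Set Implicit Arguments.
Unset Strict Implicit.
Unset Printing Implicit Defensive.
Import Order.TTheory GRing.Theory Num.Theory.
Import numFieldNormedType.Exports.
Local Open Scope classical_set_scope.
Local Open Scope ring_scope.

Section product_probability.
Context d1 d2 (T1 : measurableType d1) (T2 : measurableType d2) (R : realType).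
Variables (P1 : probability T1 R) (P2 : probability T2 R).

Let prod := (P1 \x P2)%E.

HB.instance Definition _ := Measure.on prod.

Let prod_setT : prod setT = 1%E.
Proof.
rewrite -setXTT [LHS]product_measure1E// -[RHS]mule1.
by congr (_ * _)%E; exact: probability_setT.
Qed.

HB.instance Definition _ := Measure_isProbability.Build _ _ _ prod prod_setT.

Definition prod_probability : probability (T1 * T2)%type R := prod.

End product_probability.

Section tuple_probability.
Context d (T : measurableType d) (R : realType).

Definition tuple_cons n (x : T * n.-tuple T) : n.+1.-tuple T :=
  [tuple of x.1 :: x.2].

Lemma measurable_tuple_cons n : measurable_fun setT (@tuple_cons n).
Proof. exact: measurable_cons. Qed.

HB.instance Definition _ n :=
  isMeasurableFun.Build _ _ _ _ (@tuple_cons n) (@measurable_tuple_cons n).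

(* Joint law of independent draws x_i ~ P i, see tuple_probabilityE. *)
Fixpoint tuple_probability n : ('I_n -> probability T R) ->
    probability (n.-tuple T) R :=
  match n with
  | 0 => fun=> [the probability _ _ of @dirac _ _ [tuple] R]
  | _.+1 => fun P => distribution
      (prod_probability (P ord0) (tuple_probability (fun i => P (lift ord0 i))))
      (@tuple_cons _)
  end.

Lemma tuple_probabilityE n (P : 'I_n -> probability T R) (B : 'I_n -> set T) :
  (forall i, measurable (B i)) ->
  tuple_probability P [set x | forall i, B i (tnth x i)] =
  (\prod_(i < n) P i (B i))%E.
Proof.
elim: n P B => [|n IHn] P B mB.
  by rewrite big_ord0 /= diracE mem_set//= => -[].
have mBn : measurable [set x : n.-tuple T | forall i, B (lift ord0 i) (tnth x i)].
  rewrite (_ : mkset _ =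
      \bigcap_(i : 'I_n) ((fun x => tnth x i) @^-1` B (lift ord0 i))); last first.
    by apply/seteqP; split => [x h i _|x h i] /=; [apply: h|apply: (h i)].
  apply: fin_bigcap_measurable; first exact: finite_finset.
  by move=> i _; rewrite -[X in measurable X]setTI; apply: (measurable_tnth i).
rewrite big_ord_recl -IHn// -product_measure1E//=.
rewrite /distribution /pushforward/=; congr (_ _).
apply/seteqP; split => [[x s]/= h|[x s]/= [h0 h] i].
  by split => [|i]; [exact: (h ord0)|have := h (lift ord0 i); rewrite tnthS].
by case: (unliftP ord0 i) => [j|] ->; rewrite ?tnthS//.
Qed.

End tuple_probability.

Section linear_algebra.
Context (R : realType) (d : nat).
Implicit Types (v w : 'cV[R]_d) (M A : 'M[R]_d).

Definition dotmul v w : R := (v^T *m w) 0 0.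

Definition lq_norm (q : R) v : R := (\sum_i `|v i 0| `^ q) `^ q^-1.

Definition psd A := A^T = A /\ forall v, 0 <= dotmul v (A *m v).

(* The psd square root is unique when it exists; it is 0 when M is not psd. *)
Definition psd_sqrt M : 'M[R]_d := xget 0 [set A | psd A /\ A *m A = M].

End linear_algebra.

Section subgaussian.
Context (R : realType).

Definition mean (P : probability (measurableTypeR R) R) : R :=
  fine 'E_P[fun x => x].

(* The parameter is the variance proxy sigma^2. *)
Definition subgaussian (s2 : R) (P : probability (measurableTypeR R) R) :=
  forall t : R, 0 <= t ->
  (P [set x : R | (t <= `|x - mean P|)%R] <=
   (2 * expR (- (t ^+ 2 / (2 * s2))))%:E)%E.

End subgaussian.

Section linear_bandit.
Context (R : realType) (dS dA : measure_display).
Context (S : measurableType dS) (A : measurableType dA) (d : nat).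
Variables (phi : S -> A -> 'cV[R]_d) (n : nat).

Definition feature_map := forall i,
  measurable_fun [set: S * A] (fun sa => phi sa.1 sa.2 i 0).

Record instance := Instance {
  rho : probability S R ;
  cov : 'I_n -> S * A ;
  theta : 'cV[R]_d ;
  reward : S -> A -> probability (measurableTypeR R) R ;
  reward_integrable : forall s a,
    (reward s a).-integrable setT (fun x => x%:E) ;
  reward_mean : forall s a, mean (reward s a) = dotmul (phi s a) theta }.

Definition policy := [set pi : S -> A | measurable_fun setT pi].

(* Well defined, possibly as -oo, when some optimal policy is rho-integrable:
   the positive part of the integrand is then integrable. *)
Definition value (Q : instance) (pi : S -> A) : \bar R :=
  'E_(rho Q)[fun s => dotmul (phi s (pi s)) (theta Q)].

Definition optimal_policy (Q : instance) := [set pi | policy pi /\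
  forall s a, dotmul (phi s a) (theta Q) <= dotmul (phi s (pi s)) (theta Q)].

(* A fixed measurable selection of the argmax; xget breaks ties arbitrarily. *)
Definition pistar (Q : instance) : S -> A :=
  xget (fun=> point) (optimal_policy Q).

Definition optimal_value (Q : instance) : \bar R := value Q (pistar Q).

Definition Sigma (Q : instance) : 'M[R]_d :=
  n%:R^-1 *: \sum_(i < n)
    phi (cov Q i).1 (cov Q i).2 *m (phi (cov Q i).1 (cov Q i).2)^T.

Definition mean_feature (Q : instance) (pi : S -> A) : 'cV[R]_d :=
  \col_i fine 'E_(rho Q)[fun s => phi s (pi s) i 0].

Definition CB (q Lambda : R) : set instance := [set Q |
  [/\ Sigma Q \in unitmx,
      optimal_policy Q !=set0,
      forall i, (rho Q).-integrable setT (fun s => (phi s (pistar Q s) i 0)%:E),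
      lq_norm q (invmx (psd_sqrt (Sigma Q)) *m mean_feature Q (pistar Q))
        <= Lambda
    & forall s a, subgaussian 1 (reward Q s a)]].

Definition dataset := n.-tuple (S * A * measurableTypeR R)%type.

Definition make_dataset (Q : instance)
    (r : n.-tuple (measurableTypeR R)) : dataset :=
  [tuple (cov Q i, tnth r i) | i < n].

(* The test distribution is known to the learner. *)
Definition learning_rule :=
  [set pihat : probability S R -> dataset -> S -> A | forall mu,
    measurable_fun setT (fun x : dataset * S => pihat mu x.1 x.2)].

Definition reward_law (Q : instance) :
    probability (n.-tuple (measurableTypeR R)) R :=
  tuple_probability (fun i => reward Q (cov Q i).1 (cov Q i).2).

Definition expected_suboptimality
    (pihat : probability S R -> dataset -> S -> A) (Q : instance) : \bar R :=
  (\int[reward_law Q]_r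
    (optimal_value Q - value Q (pihat (rho Q) (make_dataset Q r))))%E.

Definition minimax_suboptimality (q Lambda : R) : \bar R :=
  ereal_inf [set ereal_sup [set expected_suboptimality pihat Q
    | Q in CB q Lambda] | pihat in learning_rule].

End linear_bandit.

(* 1/p, with 1/oo = 0. *)
Definition recip (R : realType) (p : \bar R) : R := fine (p^-1)%E.

(* Main.v *)
(* The states are the natural numbers, the actions are signs, and the features
   are [phi s a = (+/-) e_s] for [s < d] and [0] for [s >= d]. The first [d]
   covariates observe each coordinate of [theta] once and the others carry no
   information, so that [Sigma] is [n^-1] times the identity. With
   [theta = (+/-1/4, ..., +/-1/4)] and [+/-1/2]-valued rewards, one observation
   per coordinate cannot reveal its sign reliably, and by Assouad's argument
   every learning rule is wrong at each state with constant probability, on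
   average over the sign patterns. If [rho] gives mass [u_i] to the state
   [i < d] and the rest to a null state, then the regret is of order
   [sum_i u_i], whereas the norm constraint reads [|sqrt n u|_q <= Lambda].
   The first bound takes [u] constant, the second takes [u] supported on a
   single state. *)

Require Import Defs.
From HB Require Import structures.
From mathcomp Require Import all_boot all_order all_algebra.
From mathcomp Require Import all_classical all_reals all_analysis.
From mathcomp Require Import measurable_realfun.
From mathcomp Require Import ring lra.
Set Implicit Arguments.
Unset Strict Implicit.
Unset Printing Implicit Defensive.
Import Order.TTheory GRing.Theory Num.Theory.
Import numFieldNormedType.Exports.
Local Open Scope classical_set_scope.
Local Open Scope ring_scope.

(** * Finitely supported probability measures *)

Section finitely_supported_probability.
Context d (T : measurableType d) (R : realType).
Variables (n : nat) (w : nat -> R) (x : nat -> T).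
Hypotheses (w_ge0 : forall k, 0 <= w k) (w_sum1 : \sum_(k < n) w k = 1).

Let atom k : {measure set T -> \bar R} :=
  mscale (NngNum (w_ge0 k)) (\d_(x k))%R.

Let fsm : set T -> \bar R := msum atom n.

HB.instance Definition _ := Measure.on fsm.

Let fsmE B : fsm B = (\sum_(k < n) w k * \1_B (x k))%:E.
Proof.
rewrite /fsm /msum -sumEFin; apply: eq_bigr => k _.
by rewrite EFinM.
Qed.

Let fsm_setT : fsm setT = 1%E.
Proof.
rewrite fsmE; under eq_bigr do rewrite indicT mulr1.
by rewrite w_sum1.
Qed.

HB.instance Definition _ := Measure_isProbability.Build _ _ _ fsm fsm_setT.

Definition finite_probability : probability T R := fsm.

Lemma finite_probabilityE B :
  finite_probability B = (\sum_(k < n) w k * \1_B (x k))%:E.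
Proof. exact: fsmE. Qed.

Lemma ge0_integral_finite_probability (f : T -> R) : measurable_fun setT f ->
  (forall t, 0 <= f t) ->
  (\int[finite_probability]_t (f t)%:E = (\sum_(k < n) w k * f (x k))%:E)%E.
Proof.
move=> mf f0.
rewrite /finite_probability /= ge0_integral_measure_sum//; last 2 first.
- by move=> t _; rewrite lee_fin.
- exact/measurable_EFinP.
rewrite -sumEFin; apply: eq_bigr => k _.
rewrite ge0_integral_mscale//; last 2 first.
- exact/measurable_EFinP.
- by move=> t _; rewrite lee_fin.
by rewrite integral_dirac ?diracT ?mul1e ?EFinM//; exact/measurable_EFinP.
Qed.

Lemma finite_probability_integrable (f : T -> R) : measurable_fun setT f ->
  finite_probability.-integrable setT (EFin \o f).
Proof.
move=> mf; apply/integrableP; split; first exact/measurable_EFinP.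
rewrite (ge0_integral_finite_probability (f := Num.norm \o f)) ?ltry//.
  exact: measurableT_comp.
by move=> t /=.
Qed.

Lemma integral_finite_probability (f : T -> R) : measurable_fun setT f ->
  (\int[finite_probability]_t (f t)%:E = (\sum_(k < n) w k * f (x k))%:E)%E.
Proof.
move=> mf; rewrite integralE.
under [X in (X - _)%E]eq_integral do rewrite funeposE -EFin_max.
under [X in (_ - X)%E]eq_integral do rewrite funenegE -EFinN -EFin_max.
rewrite (ge0_integral_finite_probability (f := f \max cst 0)); last 2 first.
- exact: measurable_maxr.
- by move=> t; rewrite le_max lexx orbT.
rewrite (ge0_integral_finite_probability (f := (\- f) \max cst 0)); last 2 first.
- by apply: measurable_maxr => //; exact: measurableT_comp.
- by move=> t; rewrite le_max lexx orbT.
rewrite -EFinB -sumrB; congr (_%:E); apply: eq_bigr => k _ /=.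
rewrite -mulrBr; congr (_ * _).
by case: (leP (f (x k)) 0) => h; case: (leP (- f (x k)) 0) => h'; lra.
Qed.

End finitely_supported_probability.

(** * Likelihood ratio bounds for product laws *)

Section tuple_probability_domination.
Context d (T : measurableType d) (R : realType).
Local Open Scope ereal_scope.

(** Lower bounds on likelihood ratios multiply over independent coordinates. The induction
    integrates, over the first coordinate, the mass of the sections under the law of the others. *)
Lemma tuple_probability_dominates n (P P' : 'I_n -> probability T R)
    (k : 'I_n -> R) :
  (forall i, 0 <= k i)%R ->
  (forall i B, measurable B -> (k i)%:E * P' i B <= P i B) ->
  forall B, measurable B ->
  (\prod_(i < n) k i)%:E * tuple_probability P' B <= tuple_probability P B.
Proof.
move=> k0; elim: n P P' k k0 => [|n IHn] P P' k k0 PP' B mB.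
  by rewrite big_ord0 mul1e.
rewrite big_ord_recl /=.
set Q' := tuple_probability _; set Q := tuple_probability _.
have {}mB : measurable (@tuple_cons _ T n @^-1` B).
  by rewrite -[X in measurable X]setTI; exact: measurable_tuple_cons.
rewrite /distribution /pushforward /=.
move: (_ @^-1` B) mB => {}B mB.
rewrite /prod_probability /= /product_measure1 /=.
have mQ := measurable_fun_xsection Q mB.
have mQ' := measurable_fun_xsection Q' mB.
pose k' := (\prod_(i < n) k (lift ord0 i))%R.
have k'0 : (0 <= k')%R by apply: prodr_ge0.
rewrite -/k' EFinM -muleA -[X in _ * X](@ge0_integralZl _ _ _ (P' ord0))//.
rewrite -(@ge0_integral_mscale _ _ _ (P' ord0) _ _ (NngNum (k0 ord0)))//;
  last 2 first.
- exact: emeasurable_funM.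
- by move=> x _; rewrite mule_ge0.
(* The factor of the first coordinate now scales the measure [P' ord0]. The chain first replaces
   that measure by [P ord0], then bounds the sections by induction. *)
apply: (@le_trans _ _ (\int[P ord0]_x (k'%:E * (Q' \o xsection B) x))).
  apply: (@ge0_le_measure_integral _ _ _
    (mscale (NngNum (k0 ord0)) (P' ord0)) (P ord0)) => //=.
  - by move=> S mS; exact: PP'.
  - by move=> x; rewrite mule_ge0.
  - exact: emeasurable_funM.
apply: ge0_le_integral => //.
- by move=> x _; rewrite mule_ge0.
- exact: emeasurable_funM.
move=> x _; apply: IHn => //.
- by move=> i C mC; exact: PP'.
- exact: measurable_xsection.
Qed.

End tuple_probability_domination.

(** * The psd square root of a scalar matrix *)

Section scalar_matrices.
Context (R : realType) (d : nat).
Implicit Type v : 'cV[R]_d.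

Lemma dotmulE v v' : dotmul v v' = \sum_i v i 0 * v' i 0.
Proof. by rewrite /dotmul mxE; apply: eq_bigr => i _; rewrite mxE. Qed.

Lemma dotmul_ge0 v : 0 <= dotmul v v.
Proof. by rewrite dotmulE sumr_ge0// => i _; rewrite -expr2 sqr_ge0. Qed.

Lemma dotmul_eq0 v : dotmul v v = 0 -> v = 0.
Proof.
move=> /eqP; rewrite dotmulE psumr_eq0; last first.
  by move=> i _; rewrite -expr2 sqr_ge0.
move=> /allP v0; apply/colP => i; rewrite mxE.
have := v0 i; rewrite mem_index_enum => /(_ isT)/=.
by rewrite mulf_eq0 orbb => /eqP.
Qed.

(** For a psd root [A] put [B = A - c]. Then [A *m B = - c B], so a nonzero column of [B] would be
    an eigenvector of [A] with a negative eigenvalue, against positivity. *)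
Lemma psd_sqrt_scalar (c : R) : 0 < c ->
  psd_sqrt ((c ^+ 2)%:M : 'M[R]_d) = c%:M.
Proof.
move=> c0; rewrite /psd_sqrt; case: xgetP => [A _ [[AT Apsd] AA]|]; last first.
  move=> /(_ c%:M)[]; split; last by rewrite -scalar_mxM expr2.
  split=> [|v]; first by rewrite tr_scalar_mx.
  rewrite mul_scalar_mx /dotmul -scalemxAr mxE mulr_ge0 ?(ltW c0)//.
  exact: dotmul_ge0.
apply/eqP; rewrite -subr_eq0; apply/eqP; set B := A - _.
have AB : A *m B = - (c *: B).
  rewrite /B mulmxBr AA scalerBr mul_mx_scalar scale_scalar_mx -expr2.
  by rewrite opprB.
apply/matrixP => i j; rewrite [RHS]mxE.
suff : col j B = 0 by move=> /colP/(_ i); rewrite !mxE.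
apply: dotmul_eq0; apply/eqP; rewrite eq_le dotmul_ge0 andbT.
have := Apsd (col j B).
rewrite colE mulmxA AB mulNmx -scalemxAl -colE -scaleNr /dotmul -scalemxAr mxE.
by rewrite mulNr oppr_ge0 pmulr_rle0.
Qed.

End scalar_matrices.

(** * Rewards with two values *)

Section two_point.
Context (R : realType) (m : R).
Hypothesis m_le : `|m| <= 4^-1.

(** On the values [1/2] and [-1/2] these weights have mean [m]; [|m| <= 1/4] keeps them between 1/4
    and 3/4, whence the likelihood ratio 3. *)
Let weight k : R := 2^-1 + (-1) ^+ k * m.

Let weight_bounds k : 4^-1 <= weight k <= 3 / 4.
Proof.
have := m_le; rewrite ler_norml /weight -signr_odd => /andP[? ?].
by case: odd; rewrite ?expr1 ?expr0; apply/andP; split; lra.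
Qed.

Let weight_ge0 k : 0 <= weight k.
Proof. by have /andP[? _] := weight_bounds k; lra. Qed.

Let weight_sum1 : \sum_(k < 2) weight k = 1.
Proof. by rewrite !big_ord_recl big_ord0 /weight /= /bump/= expr0 expr1; field. Qed.

Definition two_point : probability (measurableTypeR R) R :=
  finite_probability (fun k => (-1) ^+ k * 2^-1 : measurableTypeR R)
    weight_ge0 weight_sum1.

Lemma two_point_integrable : two_point.-integrable setT (fun x => x%:E).
Proof.
rewrite /two_point.
apply: (@finite_probability_integrable _ (measurableTypeR R) R _ _ _ _ _
  (fun x => x)).
exact: measurable_id.
Qed.

Lemma two_point_mean : mean two_point = m.
Proof.
rewrite /mean unlock.
rewrite (@integral_finite_probability _ (measurableTypeR R) R _ _ _ _ _
  (fun x => x))//=.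
by rewrite !big_ord_recl big_ord0 /weight /= /bump/= expr0 expr1; field.
Qed.

Lemma two_point_subgaussian : subgaussian 1 two_point.
Proof.
move=> t t0; rewrite two_point_mean mulr1.
rewrite finite_probabilityE lee_fin.
(* A deviation is at most [1/2 + 1/4 = 3/4], so the probability vanishes beyond. Up to there the
   bound exceeds 1: [exp (-x) >= 1 - x] gives at least [2 (1 - 9/32)]. *)
have [t34|t34] := leP t (3 / 4).
  apply: (@le_trans _ _ 1).
    rewrite -weight_sum1; apply: ler_sum => k _.
    by rewrite ler_piMr// indicE lern1 leq_b1.
  have := expR_ge1Dx (- (t ^+ 2 / 2)); nra.
rewrite big1 ?mulr_ge0 ?expR_ge0// => k _.
rewrite indicE memNset ?mulr0//=; apply/negP; rewrite -ltNge.
apply: le_lt_trans t34; rewrite (le_trans (ler_normB _ _))//.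
by rewrite normrM normrX normrN1 expr1n mul1r ger0_norm//; have := m_le; lra.
Qed.

End two_point.

Lemma eq_two_point (R : realType) (m m' : R)
    (hm : `|m| <= 4^-1) (hm' : `|m'| <= 4^-1) :
  m = m' -> two_point hm = two_point hm'.
Proof.
by move=> mm'; case: _ / mm' hm' => hm'; congr two_point; exact: bool_irrelevance.
Qed.

Lemma two_point_dominates (R : realType) (m m' : R)
    (hm : `|m| <= 4^-1) (hm' : `|m'| <= 4^-1) B :
  ((3^-1)%:E * two_point hm B <= two_point hm' B)%E.
Proof.
rewrite !finite_probabilityE -EFinM lee_fin mulr_sumr.
apply: ler_sum => k _; rewrite mulrA ler_wpM2r//.
move: hm hm'; rewrite !ler_norml -signr_odd => /andP[? ?] /andP[? ?].
by case: odd; rewrite ?expr1 ?expr0; lra.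
Qed.

(** * The hard instances, indexed by sign patterns *)

Section hard_instances.
Context (R : realType) (d n : nat).
Local Notation sgn b := ((-1) ^+ (b : bool) : R).

Definition signed_basis (s : nat) (a : bool) : 'cV[R]_d :=
  \col_i (sgn a * (s == i)%:R).

Lemma signed_basis_feature_map : feature_map signed_basis.
Proof.
move=> i; rewrite /signed_basis; under eq_fun do rewrite mxE.
apply: measurable_funM.
  by apply: (measurableT_comp (f := fun a : bool => sgn a)).
by apply: (measurableT_comp (f := fun s : nat => (s == i)%:R : R)).
Qed.

Definition sign_pattern := {ffun 'I_d -> bool}.

Definition hard_theta (sigma : sign_pattern) : 'cV[R]_d :=
  \col_i (sgn (sigma i) / 4).

Lemma dotmul_signed_basis sigma (i : 'I_d) a :
  dotmul (signed_basis i a) (hard_theta sigma) = sgn (a (+) sigma i) / 4.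
Proof.
rewrite dotmulE (bigD1 i)//= big1 ?addr0 => [|j ji]; last first.
  by rewrite !mxE (_ : (_ == _) = false) ?mulr0 ?mul0r//; apply/negbTE; rewrite eq_sym.
by rewrite !mxE eqxx mulr1 mulrA signr_addb.
Qed.

Lemma dotmul_signed_basis_null sigma s a : (d <= s)%N ->
  dotmul (signed_basis s a) (hard_theta sigma) = 0.
Proof.
move=> ds; rewrite dotmulE big1// => i _; rewrite !mxE gtn_eqF ?mulr0 ?mul0r//.
exact: leq_trans ds.
Qed.

Lemma dotmul_signed_basis_le sigma s a :
  `|dotmul (signed_basis s a) (hard_theta sigma)| <= 4^-1.
Proof.
have [sd|ds] := ltnP s d; last first.
  by rewrite dotmul_signed_basis_null// normr0.
rewrite (dotmul_signed_basis sigma (Ordinal sd)) normrM normrX normrN1 expr1n.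
by rewrite mul1r ger0_norm.
Qed.

Variables (u : nat -> R).
Hypotheses (u_ge0 : forall k, 0 <= u k) (u_sum : \sum_(i < d) u i <= 1).

Let weight k := if (k < d)%N then u k else 1 - \sum_(i < d) u i.

Let weight_ge0 k : 0 <= weight k.
Proof. by rewrite /weight; case: ifP => // _; rewrite subr_ge0. Qed.

Let weight_sum (f : nat -> R) : \sum_(k < d.+1) weight k * f k =
  \sum_(i < d) u i * f i + (1 - \sum_(i < d) u i) * f d.
Proof.
rewrite big_ord_recr/= {2}/weight ltnn; congr (_ + _).
by apply: eq_bigr => i _; rewrite /weight ltn_ord.
Qed.

Let weight_sum1 : \sum_(k < d.+1) weight k = 1.
Proof.
transitivity (\sum_(k < d.+1) weight k * 1).
  by apply: eq_bigr => k; rewrite mulr1.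
rewrite (weight_sum (fun=> 1)) mulr1.
by under eq_bigr do rewrite mulr1; rewrite addrC subrK.
Qed.

(* The mass left over sits on the state [d], whose features vanish. *)
Definition hard_rho : probability nat R :=
  finite_probability id weight_ge0 weight_sum1.

Lemma hard_rho_expectation (f : nat -> R) : f d = 0 ->
  ('E_hard_rho[f] = (\sum_(i < d) u i * f i)%:E)%E.
Proof.
move=> fd; rewrite unlock integral_finite_probability//.
by rewrite weight_sum fd mulr0 addr0.
Qed.

Definition hard_instance (sigma : sign_pattern) : instance signed_basis n :=
  @Instance _ _ _ _ _ _ _ _ hard_rho (fun i => (i : nat, false))
    (hard_theta sigma)
    (fun s a => two_point (dotmul_signed_basis_le sigma s a))
    (fun s a => two_point_integrable _)
    (fun s a => two_point_mean _).

Lemma value_hard_instance sigma pi : value (hard_instance sigma) pi =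
  (\sum_(i < d) u i * (sgn (pi i (+) sigma i) / 4))%:E.
Proof.
rewrite /value hard_rho_expectation/=; last exact: dotmul_signed_basis_null.
by congr (_%:E); apply: eq_bigr => i _; rewrite dotmul_signed_basis.
Qed.

Lemma optimal_policy_hard_instance sigma :
  optimal_policy (hard_instance sigma) !=set0.
Proof.
exists (fun s => if insub s is Some i then sigma i else false); split=> // s a /=.
have [sd|ds] := ltnP s d; last by rewrite !dotmul_signed_basis_null.
rewrite insubT /= !(dotmul_signed_basis sigma (Ordinal sd)) addbb.
by case: (_ (+) _); rewrite ?expr1 ?expr0; lra.
Qed.

(** Below [d] the two actions have values [1/4] and [-1/4], so the maximizer is unique and the
    arbitrary choice made by [xget] is forced. *)
Lemma pistar_hard_instance sigma (i : 'I_d) :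
  pistar (hard_instance sigma) (i : nat) = sigma i.
Proof.
have [_ opt] := xgetPex (fun=> point) (optimal_policy_hard_instance sigma).
have := opt (nat_of_ord i) (sigma i).
rewrite /pistar !dotmul_signed_basis addbb.
by case: (xget _ _ _) (sigma i) => -[]//=; rewrite ?expr1 ?expr0; lra.
Qed.

(** A wrong decision turns the value [1/4] into [-1/4], a loss of [1/2]. *)
Lemma optimal_value_hard_instance sigma pi :
  (optimal_value (hard_instance sigma) - value (hard_instance sigma) pi =
   (\sum_(i < d) u i / 2 * (pi i != sigma i)%:R)%:E)%E.
Proof.
rewrite /optimal_value !value_hard_instance -EFinB -sumrB.
congr (_%:E); apply: eq_bigr => i _; rewrite pistar_hard_instance addbb.
by case: (pi i) (sigma i) => -[]/=; rewrite ?expr1 ?expr0; field.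
Qed.

Hypotheses (d_gt0 : (0 < d)%N) (dn : (d <= n)%N).

(** Since [d <= n], each basis vector occurs exactly once among the covariates; those of index at
    least [d] have zero features. *)
Lemma Sigma_hard_instance sigma : Sigma (hard_instance sigma) = (n%:R^-1)%:M.
Proof.
apply/matrixP => i j; rewrite !mxE summxE; have iI := leq_trans (ltn_ord i) dn.
rewrite (bigD1 (Ordinal iI))//= big1 ?addr0 => [|k ki].
  rewrite mxE big_ord1 !mxE eqxx/= mulr1 mul1r expr0 mul1r.
  by rewrite mulr_natr -val_eqE.
rewrite mxE big_ord1 !mxE/= (_ : (_ == _ :> nat) = false) ?mulr0 ?mul0r//.
by apply/negbTE; rewrite -val_eqE/= in ki.
Qed.

(** The inverse root of [Sigma] is multiplication by [sqrt n], and coordinate [i] of the mean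
    feature is [u i] up to the sign of the optimal action, which the norm ignores. *)
Lemma hard_instance_CB sigma (q Lambda : R) :
  (\sum_(i < d) (Num.sqrt n%:R * u i) `^ q) `^ q^-1 <= Lambda ->
  CB q Lambda (hard_instance sigma).
Proof.
move=> uq; have n0 : 0 < n%:R :> R by rewrite ltr0n (leq_trans d_gt0).
split.
- by rewrite Sigma_hard_instance unitmxE det_scalar unitrX// unitfE invr_eq0 gt_eqF.
- exact: optimal_policy_hard_instance.
- by move=> i; exact: finite_probability_integrable.
- have sqn : n%:R^-1 = (Num.sqrt n%:R)^-1 ^+ 2 :> R.
    by rewrite exprVn sqr_sqrtr ?ler0n.
  have s0 : 0 < (Num.sqrt n%:R)^-1 :> R by rewrite invr_gt0 sqrtr_gt0.
  rewrite Sigma_hard_instance sqn (psd_sqrt_scalar _ s0).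
  rewrite invmx_scalar mul_scalar_mx invrK.
  apply: le_trans uq; rewrite /lq_norm le_eqVlt; apply/orP; left; apply/eqP.
  congr (_ `^ _); apply: eq_bigr => i _; rewrite !mxE hard_rho_expectation; last first.
    by rewrite mxE gtn_eqF ?mulr0.
  rewrite (bigD1 i)//= big1 ?addr0 => [|j ji]; last first.
    by rewrite mxE (_ : (_ == _ :> nat) = false) ?mulr0//; apply/negbTE; rewrite val_eqE.
  rewrite mxE eqxx mulr1 normrM ger0_norm ?sqrtr_ge0//.
  by rewrite normrM normrX normrN1 expr1n mulr1 ger0_norm.
- by move=> s a; exact: two_point_subgaussian.
Qed.

End hard_instances.

(** * Assouad's argument over the sign patterns *)

Section assouad.
Context (R : realType) (d n : nat) (u : nat -> R).
Hypotheses (u_ge0 : forall k, 0 <= u k) (u_sum : \sum_(i < d) u i <= 1).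
Hypotheses (d_gt0 : (0 < d)%N) (dn : (d <= n)%N).
Variable pihat : probability nat R -> dataset R nat bool n -> nat -> bool.
Hypothesis pihat_rule :
  learning_rule (R := R) (S := nat) (A := bool) (n := n) pihat.

Let Q := hard_instance n u_ge0 u_sum.
Let rho0 := hard_rho u_ge0 u_sum.
Let P sigma := reward_law (Q sigma).

Let observed (r : n.-tuple (measurableTypeR R)) : dataset R nat bool n :=
  [tuple ((j : nat, false), tnth r j) | j < n].

(** The test distribution and the covariates are the same for all [sigma], so the learner's choice
    depends on [sigma] only through the rewards. *)
Let decision r (i : 'I_d) : bool := pihat rho0 (observed r) i.

Let wrong sigma i := [set r | decision r i != sigma i].

Let measurable_wrong sigma i : measurable (wrong sigma i).
Proof.
have mobs : measurable_fun setT (fun r => (observed r, nat_of_ord i)).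
  apply: measurable_fun_pair => //; apply/measurable_fun_tnthP => j.
  rewrite (_ : _ \o _ = fun r => ((j : nat, false), tnth r j)); last first.
    by apply/funext => r /=; rewrite tnth_mktuple.
  by apply: measurable_fun_pair => //; exact: measurable_tnth.
have mdec := measurableT_comp (pihat_rule rho0) mobs.
rewrite (_ : wrong sigma i = decision^~ i @^-1` [set b | b != sigma i])//.
by rewrite -[X in measurable X]setTI; exact: mdec.
Qed.

Let p sigma i := fine (P sigma (wrong sigma i)).

Let expected_suboptimalityE sigma : expected_suboptimality pihat (Q sigma) =
  (\sum_(i < d) u i / 2 * p sigma i)%:E.
Proof.
rewrite /expected_suboptimality.
transitivity (\int[P sigma]_r (\sum_(i < d)
    ((u i / 2)%:E * (\1_(wrong sigma i) r)%:E)))%E.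
  apply: eq_integral => r _; rewrite optimal_value_hard_instance -sumEFin.
  by apply: eq_bigr => i _; rewrite indicE mem_setE EFinM.
rewrite ge0_integral_sum//; last 2 first.
- move=> i; apply: emeasurable_funM => //.
  by apply/measurable_EFinP; exact: measurable_indic.
- by move=> i r _; rewrite -EFinM lee_fin mulr_ge0// divr_ge0.
rewrite -sumEFin; apply: eq_bigr => i _.
rewrite ge0_integralZl_EFin ?divr_ge0//; last first.
  by apply/measurable_EFinP; exact: measurable_indic.
by rewrite integral_indic// setIT [RHS]EFinM /p fineK// fin_num_measure.
Qed.

Let flip (i : 'I_d) (sigma : sign_pattern d) : sign_pattern d :=
  [ffun j => sigma j (+) (j == i)].

Let flipK i : involutive (flip i).
Proof. by move=> s; apply/ffunP => j; rewrite !ffunE -addbA addbb addbF. Qed.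

(** Only the [i]-th observation has a law that depends on [sigma i]; its two possible laws are
    within a factor 3 of each other. *)
Let flip_dominates i sigma B : measurable B ->
  ((3^-1)%:E * P (flip i sigma) B <= P sigma B)%E.
Proof.
move=> mB; pose k (j : 'I_n) : R := if j == i :> nat then 3^-1 else 1.
have -> : 3^-1 = \prod_j k j.
  rewrite (bigD1 (widen_ord dn i))//= /k eqxx big1 ?mulr1// => j /negbTE.
  by rewrite -val_eqE/= => ->.
apply: tuple_probability_dominates => // [j|j C mC].
  by rewrite /k; case: ifP.
rewrite /k; case: ifP => [_|/negbT ji].
  exact: two_point_dominates.
have same : reward (Q (flip i sigma)) (nat_of_ord j) false =
    reward (Q sigma) (nat_of_ord j) false.
  apply: eq_two_point.
  have [jd|dj] := ltnP j d; last by rewrite !dotmul_signed_basis_null.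
  rewrite !(dotmul_signed_basis _ _ (Ordinal jd)) ffunE.
  by rewrite (_ : (_ == _) = false) ?addbF//; apply/negbTE; rewrite -val_eqE.
by rewrite mul1e -[leLHS]/(reward (Q (flip i sigma)) (nat_of_ord j) false C) same.
Qed.

(* Flipping one sign exchanges right and wrong decisions at that state, but
   changes the likelihood of the rewards at most by a factor 3. *)
Let two_point_risk i sigma : 3^-1 <= p sigma i + p (flip i sigma) i.
Proof.
have wrong_flip : wrong (flip i sigma) i = ~` wrong sigma i.
  apply/seteqP; split=> r; rewrite /wrong /= ffunE eqxx addbT;
    by case: (decision r i) (sigma i) => -[].
have mW := measurable_wrong sigma i.
have PE tau : P tau (wrong sigma i) = (fine (P tau (wrong sigma i)))%:E.
  by rewrite fineK// fin_num_measure.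
have := flip_dominates i sigma mW.
have : (P (flip i sigma) (wrong sigma i) <= 1)%E by exact: probability_le1.
rewrite /p wrong_flip probability_setC// (PE sigma) (PE (flip i sigma)).
(* If [x] and [y] are the probabilities of [wrong sigma i] under [sigma] and its flip, then
   [x >= y/3] and [y <= 1] give [x + 1 - y >= 1 - 2y/3 >= 1/3]. *)
by rewrite -EFinB -EFinM !lee_fin /=; lra.
Qed.

(** Some pattern is at least as bad as the average one. On average the error probability at each
    state is at least 1/6, and an error at [i] costs [u i / 2], whence the constant 1/12. *)
Lemma exists_hard_instance : exists sigma : sign_pattern d,
  ((12^-1 * \sum_(i < d) u i)%:E <= expected_suboptimality pihat (Q sigma))%E.
Proof.
apply/existsP; apply: contraT => /existsPn small.
pose N : R := #|sign_pattern d|%:R.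
have sum_cst c : \sum_(s : sign_pattern d) c = N * c.
  by rewrite sumr_const mulr_natl.
have : \sum_sigma \sum_(i < d) u i / 2 * p sigma i <
    \sum_(sigma : sign_pattern d) 12^-1 * \sum_(i < d) u i.
  apply: ltr_sum => [|s _].
    by apply/hasP; exists [ffun=> false]; rewrite ?mem_index_enum.
  by have := small s; rewrite expected_suboptimalityE lee_fin -ltNge.
rewrite exchange_big/= sum_cst ltNge => /negP[].
rewrite mulrA mulr_sumr; apply: ler_sum => i _; rewrite -mulr_sumr.
have : N * 3^-1 <= 2 * \sum_sigma p sigma i.
  (* The sum is counted twice, the second time reindexed by the flip at [i], so that each term is
     the joint risk of a pair. *)
  rewrite -sum_cst mulr2n mulrDl mul1r.
  rewrite [X in _ + X](reindex_inj (inv_inj (flipK i)))/= -big_split/=.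
  by apply: ler_sum => s _; exact: two_point_risk.
have := u_ge0 i; nra.
Qed.

End assouad.

(** * Lower bounds from choices of the masses [u] *)

Lemma minimax_lower_bound (R : realType) (d n : nat) (u : nat -> R)
    (q Lambda : R) :
  (forall k, 0 <= u k) -> \sum_(i < d) u i <= 1 -> (0 < d)%N -> (d <= n)%N ->
  (\sum_(i < d) (Num.sqrt n%:R * u i) `^ q) `^ q^-1 <= Lambda ->
  ((12^-1 * \sum_(i < d) u i)%:E <=
   minimax_suboptimality (@signed_basis R d) n q Lambda)%E.
Proof.
move=> u0 u1 d0 dn uq; apply: le_ereal_inf_tmp => _ [pihat rule <-].
have [sigma le_sigma] := exists_hard_instance u0 u1 dn rule.
apply: le_trans le_sigma _; apply: ereal_sup_ubound.
exists (hard_instance n u0 u1 sigma); last by [].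
exact: hard_instance_CB.
Qed.

Lemma recip_conjugate (R : realType) (p : \bar R) (q : R) :
  (1 <= p)%E -> 1 <= q -> (p^-1 + (q%:E)^-1 = 1)%E -> recip p + q^-1 = 1.
Proof.
move=> p1 q1; rewrite /recip [(q%:E)^-1%E]inver gt_eqF ?(lt_le_trans _ q1)//.
case: p p1 => [r||]//= r1; last by rewrite invey/= -EFinD => -[].
rewrite lee_fin in r1.
by rewrite inver gt_eqF ?(lt_le_trans _ r1)//= -EFinD => -[].
Qed.

(** Here [a] stands for [1/p]. The equal masses [Lambda d^a / (d sqrt n)] turn the norm constraint
    into an equality, and the lower bound on [n] says that their total [Lambda d^a / sqrt n] is at
    most 1. *)
Lemma minimax_lower_bound_spread (R : realType) (d n : nat) (a q Lambda : R) :
  (0 < d)%N -> 0 <= a -> a + q^-1 = 1 -> 1 <= q ->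
  Num.sqrt 8 * d%:R `^ (q^-1 - 2^-1) <= Lambda ->
  d%:R `^ (2 * a) * Lambda ^+ 2 <= n%:R ->
  ((12^-1 * d%:R `^ a * Num.sqrt (n%:R^-1) * Lambda)%:E <=
   minimax_suboptimality (@signed_basis R d) n q Lambda)%E.
Proof.
move=> d0 a0 aq q1 Lambda_ge n_ge.
have q0 : 0 < q by exact: lt_le_trans q1.
have D0 : 0 < d%:R :> R by rewrite ltr0n.
set A := d%:R `^ a; set B := d%:R `^ (q^-1 - 2^-1).
have A0 : 0 < A by exact: powR_gt0.
have B0 : 0 < B by exact: powR_gt0.
have A2 : d%:R `^ (2 * a) = A ^+ 2 by rewrite mulrC powRrM powR_mulrn ?ltW.
have L0 : 0 < Lambda by rewrite (lt_le_trans _ Lambda_ge)// mulr_gt0// sqrtr_gt0.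
(* The exponents add up to [2a + 2/q - 1 = 1]. Hence [8 d <= A^2 Lambda^2 <= n], which is how the
   lower bound on [Lambda] yields [d <= n]. *)
have AB : A ^+ 2 * B ^+ 2 = d%:R.
  rewrite -exprMn -powRD; last by rewrite (gt_eqF D0) implybT.
  rewrite -powR_mulrn ?powR_ge0// -powRrM (_ : _ * _ = 1) ?powRr1 ?ltW//.
  lra.
have B2 : 8 * B ^+ 2 <= Lambda ^+ 2.
  rewrite -[8 in X in X * _](@sqr_sqrtr _ 8)// -exprMn lerXn2r ?nnegrE//.
    by rewrite mulr_ge0 ?sqrtr_ge0// ltW.
  exact: ltW.
have n8d : 8 * d%:R <= n%:R :> R.
  by rewrite (le_trans _ n_ge)// A2 -AB; have := sqr_ge0 A; nra.
have dn : (d <= n)%N by rewrite -(ler_nat R); lra.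
have n0 : 0 < n%:R :> R by lra.
set s := Num.sqrt (n%:R : R); have s0 : 0 < s by rewrite sqrtr_gt0.
have sum_u : \sum_(i < d) Lambda * A / (s * d%:R) = Lambda * A / s.
  by rewrite sumr_const card_ord -mulr_natl; field; rewrite !gt_eqF.
rewrite (_ : _ * _ = 12^-1 * \sum_(i < d) Lambda * A / (s * d%:R)); last first.
  by rewrite sum_u sqrtrV ?ltW// -/s; field; rewrite gt_eqF.
apply: (minimax_lower_bound (u := fun=> Lambda * A / (s * d%:R))) => //.
- by move=> _; rewrite divr_ge0// mulr_ge0 ?ltW.
- have LA0 : 0 <= Lambda * A by rewrite mulr_ge0 ?ltW.
  rewrite sum_u ler_pdivrMr// mul1r -(ger0_norm LA0) -sqrtr_sqr.
  by rewrite ler_sqrt// exprMn mulrC -A2.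
rewrite -/s (_ : s * _ = Lambda * (A / d%:R)); last by field; rewrite !gt_eqF.
set v := Lambda * _; have v0 : 0 <= v by rewrite !mulr_ge0 ?invr_ge0// ltW.
(* The norm is [d^(1/q) v] with [v = Lambda A / d]; this identity makes it equal to [Lambda]. *)
have DA : d%:R `^ q^-1 * A = d%:R.
  rewrite -powRD; last by rewrite (gt_eqF D0) implybT.
  by rewrite addrC aq powRr1 ?ler0n.
rewrite sumr_const card_ord -mulr_natl powRM ?powR_ge0 ?ler0n//.
rewrite -powRrM mulfV ?(gt_eqF q0)// powRr1// /v mulrCA [_ `^ _ * _]mulrA DA.
by rewrite mulfV ?(gt_eqF D0)// mulr1.
Qed.

(** Mass [Lambda / sqrt n] on state 0 alone has norm exactly [Lambda]. The bound on [Lambda] no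
    longer gives [d <= n], which is assumed separately: with fewer than [d] samples [Sigma] is
    singular. *)
Lemma minimax_lower_bound_single (R : realType) (d n : nat) (Lambda : R) :
  (0 < d)%N -> (d <= n)%N -> 0 <= Lambda -> Lambda ^+ 2 <= n%:R ->
  ((12^-1 * Num.sqrt (n%:R^-1) * Lambda)%:E <=
   minimax_suboptimality (@signed_basis R d) n 1 Lambda)%E.
Proof.
case: d => // d _ dn L0 n_ge; have n0 : 0 < n%:R :> R.
  by rewrite ltr0n; exact: leq_trans dn.
set s := Num.sqrt (n%:R : R); have s0 : 0 < s by rewrite sqrtr_gt0.
pose u k : R := if k is 0%N then Lambda / s else 0.
have sum_u : \sum_(i < d.+1) u i = Lambda / s.
  by rewrite big_ord_recl/= big1 ?addr0.
rewrite (_ : _ * _ = 12^-1 * \sum_(i < d.+1) u i); last first.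
  by rewrite sum_u sqrtrV ?ltW// -/s; ring.
apply: minimax_lower_bound => //.
- by move=> [|k]//=; rewrite divr_ge0// ltW.
- by rewrite sum_u ler_pdivrMr// mul1r -(ger0_norm L0) -sqrtr_sqr ler_sqrt// ltW.
rewrite invr1 powRr1; last by apply: sumr_ge0 => i _; exact: powR_ge0.
rewrite big_ord_recl/= big1 ?addr0 => [|i _]; last by rewrite mulr0 powR0.
by rewrite -/s mulrCA mulfV ?gt_eqF// mulr1 powRr1.
Qed.

Theorem theorem2 (R : realType) :
  exists c : R, 0 < c /\
  forall d : nat, (2 <= d)%N ->
  exists (dS dA : measure_display) (S : measurableType dS)
    (A : measurableType dA) (phi : S -> A -> 'cV[R]_d),
  [/\ feature_map phi,
    (forall (p : \bar R) (q Lambda : R) (n : nat),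
      (1 <= p)%E -> 1 <= q -> (p^-1 + (q%:E)^-1 = 1)%E ->
      Num.sqrt 8 * d%:R `^ (q^-1 - 2^-1) <= Lambda ->
      d%:R `^ (2 * recip p) * Lambda ^+ 2 <= n%:R ->
      ((c * d%:R `^ recip p * Num.sqrt (n%:R^-1) * Lambda)%:E
        <= minimax_suboptimality phi n q Lambda)%E)
  & (forall (Lambda : R) (n : nat),
      2 <= Lambda -> Lambda ^+ 2 <= n%:R -> (d <= n)%N ->
      ((c * d%:R `^ recip (+oo%E : \bar R) * Num.sqrt (n%:R^-1) * Lambda)%:E
        <= minimax_suboptimality phi n 1 Lambda)%E)].
Proof.
exists 12^-1; split=> // d d2; have d0 : (0 < d)%N by exact: ltnW.
exists _, _, nat, bool, (@signed_basis R d); split.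
- exact: signed_basis_feature_map.
- move=> p q Lambda n p1 q1 pq; apply: minimax_lower_bound_spread => //.
    by rewrite /recip fine_ge0// inve_ge0 (le_trans _ p1).
  exact: recip_conjugate.
- move=> Lambda n Lambda2 n_ge dn.
  (* By [1/oo = 0] the power of [d] is 1, so the bound for a single state has the required form. *)
  rewrite /recip invey/= powRr0 mulr1.
  by apply: minimax_lower_bound_single => //; lra.
Qed.
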